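(* If $r\in\mathcal M_{0,0,0}$, then $3r\in\mathcal M_{2,2,2}$. Conversely, if $R\in\mathcal M_{2,2,2}$, then $R/3\in\mathcal M_{0,0,0}$.
   Context: For $(k_1,k_2,k_3)\in\mathbb Z_{\ge0}^3$, the $(k_1,k_2,k_3)$-generalized Markov equation is $x_1^2+x_2^2+x_3^2+k_1x_2x_3+k_2x_3x_1+k_3x_1x_2=(3+k_1+k_2+k_3)x_1x_2x_3$. For $n\in\mathbb Z_{\ge1}$ and $i\in\{1,2,3\}$ put $\Delta(n,i):=((3+k_1+k_2+k_3)n-k_i)^2-4$. The $(k_1,k_2,k_3)$-generalized discrete Markov spectrum is \[\mathcal M_{k_1,k_2,k_3}:=\left\{\frac{\sqrt{\Delta(x_i,i)}}{x_i}\ \middle|\ (x_1,x_2,x_3)\in\mathbb Z_{>0}^3 \text{ solves the }(k_1,k_2,k_3)\text{-generalized Markov equation},\ i\in\{1,2,3\}\right\}.\] In particular $\mathcal M_{0,0,0}=\{\sqrt{9n^2-4}/n \mid n \text{ a Markov number}\}$ (Markov numbers being the entries of positive integer solutions of $x^2+y^2+z^2=3xyz$), and $\mathcal M_{2,2,2}=\{\sqrt{(9n-2)^2-4}/n\mid n \text{ an entry of a positive integer solution of } x^2+y^2+z^2+2yz+2zx+2xy=9xyz\}$. *)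

(* Defs.v *)
From Stdlib Require Import Reals ZArith Ensembles.

Open Scope Z_scope.

Inductive index : Set := I1 | I2 | I3.

Definition entry {A : Type} (a1 a2 a3 : A) (i : index) : A :=
  match i with I1 => a1 | I2 => a2 | I3 => a3 end.

Definition gen_markov_eq (k1 k2 k3 : nat) (x1 x2 x3 : Z) : Prop :=
  x1 ^ 2 + x2 ^ 2 + x3 ^ 2
    + Z.of_nat k1 * x2 * x3 + Z.of_nat k2 * x3 * x1 + Z.of_nat k3 * x1 * x2
  = (3 + Z.of_nat k1 + Z.of_nat k2 + Z.of_nat k3) * x1 * x2 * x3.

Definition Delta (k1 k2 k3 : nat) (n : Z) (i : index) : Z :=
  ((3 + Z.of_nat k1 + Z.of_nat k2 + Z.of_nat k3) * n
     - Z.of_nat (entry k1 k2 k3 i)) ^ 2 - 4.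

(* Delta is positive whenever n >= 1, so the square root is a genuine one. *)
Definition markov_spectrum (k1 k2 k3 : nat) : Ensemble R :=
  fun r => exists (x1 x2 x3 : Z) (i : index),
    (0 < x1 /\ 0 < x2 /\ 0 < x3) /\
    gen_markov_eq k1 k2 k3 x1 x2 x3 /\
    (r = sqrt (IZR (Delta k1 k2 k3 (entry x1 x2 x3 i) i))
         / IZR (entry x1 x2 x3 i))%R.

(* Main.v *)
(** The [(2,2,2)]-equation reads [(x + y + z)^2 = 9 x y z], so [(a, b, c)] is a
    Markov triple exactly when [(a^2, b^2, c^2)] solves it, and
    [(9 n^2 - 2)^2 - 4 = (3 n)^2 (9 n^2 - 4)] matches the spectra.  That all its
    positive solutions consist of squares follows by Vieta descent: the
    conjugate [x'] of the largest entry [x] satisfies [x x' = (y + z)^2], hence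
    is smaller than [x] as soon as [x > y + z]; the only solution with
    [x <= y + z] is [(1, 1, 1)]. *)

Require Import Defs.
From Stdlib Require Import Reals ZArith Ensembles Lia Lra.

Lemma gen_markov_eq_000 (a b c : Z) :
  gen_markov_eq 0 0 0 a b c <-> a ^ 2 + b ^ 2 + c ^ 2 = 3 * a * b * c.
Proof. unfold gen_markov_eq; split; intros H; nia. Qed.

Lemma gen_markov_eq_222 (x y z : Z) :
  gen_markov_eq 2 2 2 x y z <-> (x + y + z) ^ 2 = 9 * x * y * z.
Proof. unfold gen_markov_eq; split; intros H; nia. Qed.

Lemma sqr_triple_of_markov (a b c : Z) :
  a ^ 2 + b ^ 2 + c ^ 2 = 3 * a * b * c ->
  (a ^ 2 + b ^ 2 + c ^ 2) ^ 2 = 9 * a ^ 2 * b ^ 2 * c ^ 2.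
Proof. intros ->; ring. Qed.

(** The sum is at most 2 (y + z) <= 4 y, so 9 x y z <= 16 y^2 <= 16 x y, which forces z = 1. *)
Lemma minimal_solution_sorted (x y z : Z) :
  0 < z -> z <= y -> y <= x -> x <= y + z ->
  (x + y + z) ^ 2 = 9 * x * y * z -> x = 1 /\ y = 1 /\ z = 1.
Proof.
  intros Hz Hzy Hyx Hx E.
  assert (Hs : (x + y + z) ^ 2 <= (4 * y) ^ 2) by (apply Z.pow_le_mono_l; lia).
  assert (Hyy : y * y <= x * y) by (apply Z.mul_le_mono_nonneg_r; lia).
  destruct (Z.le_gt_cases z 1) as [Hz1 | Hz1].
  2: { assert (x * y * 2 <= x * y * z) by (apply Z.mul_le_mono_nonneg_l; lia). nia. }
  assert (z = 1) as -> by lia.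
  assert (Hc : x = y \/ x = y + 1) by lia.
  (* For x = y the equation is (2 y + 1)^2 = 9 y^2, so y = 1; for x = y + 1 it reduces to 4 (y + 1)
     = 9 y, which has no integer solution. *)
  destruct Hc as [-> | ->]; nia.
Qed.

Lemma minimal_solution (x y z : Z) :
  0 < y -> 0 < z -> y <= x -> z <= x -> x <= y + z ->
  (x + y + z) ^ 2 = 9 * x * y * z -> x = 1 /\ y = 1 /\ z = 1.
Proof.
  intros Hy Hz Hyx Hzx Hx E.
  destruct (Z.le_ge_cases z y).
  - now apply minimal_solution_sorted.
  - destruct (minimal_solution_sorted x z y) as (? & ? & ?); try lia.
Qed.

Definition markov_square_triple (x y z : Z) : Prop :=
  exists a b c : Z, (0 < a /\ 0 < b /\ 0 < c) /\
    a ^ 2 + b ^ 2 + c ^ 2 = 3 * a * b * c /\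
    x = a ^ 2 /\ y = b ^ 2 /\ z = c ^ 2.

Lemma markov_square_triple_swap12 (x y z : Z) :
  markov_square_triple x y z -> markov_square_triple y x z.
Proof.
  intros (a & b & c & ? & E & ? & ? & ?); exists b, a, c.
  repeat split; try tauto; lia.
Qed.

Lemma markov_square_triple_swap13 (x y z : Z) :
  markov_square_triple x y z -> markov_square_triple z y x.
Proof.
  intros (a & b & c & ? & E & ? & ? & ?); exists c, b, a.
  repeat split; try tauto; lia.
Qed.

(** Vieta moves commute with squaring: the Markov conjugate a' = 3 b c - a satisfies a a' = b^2 +
    c^2 = y + z, so x a^2 = (a a')^2 and x = a'^2. The same product shows a' > 0. *)
Lemma markov_square_triple_vieta (x x' y z : Z) :
  x * x' = (y + z) ^ 2 ->
  markov_square_triple x' y z -> markov_square_triple x y z.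
Proof.
  intros P (a & b & c & (Ha & Hb & Hc) & E & -> & -> & ->).
  assert (Q : a * (3 * b * c - a) = b ^ 2 + c ^ 2) by nia.
  exists (3 * b * c - a), b, c.
  repeat split; try assumption; try nia.
Qed.

Lemma markov_square_triple_of_solution (x y z : Z) :
  0 < x -> 0 < y -> 0 < z -> (x + y + z) ^ 2 = 9 * x * y * z ->
  markov_square_triple x y z.
Proof.
  (* Strong induction on the sum of the entries, which a Vieta move at the largest entry
     decreases. *)
  cut (forall n x y z : Z, 0 <= n -> x + y + z = n -> 0 < x -> 0 < y -> 0 < z ->
         (x + y + z) ^ 2 = 9 * x * y * z -> markov_square_triple x y z).
  { intros H Hx Hy Hz E. apply (H (x + y + z)); trivial; lia. }
  clear x y z. intros n x y z Hn. revert x y z.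
  pattern n. apply Zlt_0_ind; [clear n Hn | exact Hn].
  intros n IH Hn.
  assert (Hmax : forall x y z, x + y + z = n -> 0 < x -> 0 < y -> 0 < z ->
            y <= x -> z <= x ->
            (x + y + z) ^ 2 = 9 * x * y * z -> markov_square_triple x y z).
  { intros x y z Hs Hx Hy Hz Hyx Hzx E.
    destruct (Z.le_gt_cases x (y + z)) as [Hle | Hgt].
    - destruct (minimal_solution x y z) as (-> & -> & ->); trivial.
      exists 1, 1, 1; lia.
    (* The equation is T^2 - (9 y z - 2 (y + z)) T + (y + z)^2 = 0 at T = x, and [x'] is its other
       root. Since 0 < (y + z)^2 < x^2, the product of the roots gives 0 < x' < x. *)
    - set (x' := 9 * y * z - 2 * (y + z) - x).
      assert (P : x * x' = (y + z) ^ 2) by (unfold x'; nia).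
      assert (Hx' : 0 < x') by nia.
      assert (Hlt : x' < x) by nia.
      apply (markov_square_triple_vieta x x'); [exact P |].
      apply (IH (x' + y + z)); trivial; try lia. }
  intros x y z Hs Hx Hy Hz E.
  assert (Hc : (y <= x /\ z <= x) \/ (x <= y /\ z <= y) \/ (x <= z /\ y <= z)) by lia.
  destruct Hc as [[] | [[] | []]].
  - now apply Hmax.
  - apply markov_square_triple_swap12, Hmax; trivial; lia.
  - apply markov_square_triple_swap13, Hmax; trivial; lia.
Qed.

Lemma entry_map {A B : Type} (f : A -> B) (a1 a2 a3 : A) (i : index) :
  entry (f a1) (f a2) (f a3) i = f (entry a1 a2 a3 i).
Proof. now destruct i. Qed.

Lemma Delta_222_sqr (n : Z) (i : index) :
  Defs.Delta 2 2 2 (n ^ 2) i = (3 * n) ^ 2 * Defs.Delta 0 0 0 n i.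
Proof. unfold Defs.Delta; destruct i; simpl entry; simpl Z.of_nat; ring. Qed.

(** The factor (3 n)^2 of the discriminant leaves the root as 3 n, and 3 n / n^2 = 3 / n. *)
Lemma spectrum_value_sqr (n : Z) (i : index) : 0 < n ->
  (sqrt (IZR (Defs.Delta 2 2 2 (n ^ 2) i)) / IZR (n ^ 2)
   = 3 * (sqrt (IZR (Defs.Delta 0 0 0 n i)) / IZR n))%R.
Proof.
  intros Hn. pose proof (IZR_lt _ _ Hn) as HnR.
  rewrite Delta_222_sqr, mult_IZR, sqrt_mult_alt by (apply IZR_le; nia).
  replace (IZR ((3 * n) ^ 2)) with (Rsqr (3 * IZR n))
    by (rewrite Z.pow_2_r, !mult_IZR; unfold Rsqr; ring).
  rewrite sqrt_Rsqr by lra.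
  rewrite Z.pow_2_r, mult_IZR. field. lra.
Qed.

Theorem theorem6p9 :
  (forall r : R, In R (markov_spectrum 0 0 0) r ->
                 In R (markov_spectrum 2 2 2) (3 * r)%R) /\
  (forall r : R, In R (markov_spectrum 2 2 2) r ->
                 In R (markov_spectrum 0 0 0) (r / 3)%R).
Proof.
  split; intros r.
  - intros (a & b & c & i & (Ha & Hb & Hc) & E & ->).
    apply gen_markov_eq_000 in E.
    exists (a ^ 2), (b ^ 2), (c ^ 2), i. split; [| split].
    + repeat split; nia.
    + now apply gen_markov_eq_222, sqr_triple_of_markov.
    (* Squaring is pulled out of the choice of entry, so the same index [i] serves both spectra. *)
    + rewrite (entry_map (fun n => n ^ 2)), spectrum_value_sqr; trivial.
      now destruct i.
  - intros (x & y & z & i & (Hx & Hy & Hz) & E & ->).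
    apply gen_markov_eq_222 in E.
    destruct (markov_square_triple_of_solution x y z Hx Hy Hz E)
      as (a & b & c & (Ha & Hb & Hc) & M & -> & -> & ->).
    exists a, b, c, i. split; [| split].
    + now repeat split.
    + now apply gen_markov_eq_000.
    + rewrite (entry_map (fun n => n ^ 2)), spectrum_value_sqr by now destruct i.
      field. apply not_0_IZR. destruct i; simpl; lia.
Qed.
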